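(* Let $\mathcal{O}$ be a Krull ring with field of fractions $K$, let $A$ be an $\mathcal{O}$-algebra which is free and finitely generated as an $\mathcal{O}$-module, and let $\theta:\mathcal{O}\rightarrow L$ be a ring homomorphism into a field $L$ such that $L$ is the field of fractions of $\theta(\mathcal{O})$. Write $KA:=K\otimes_{\mathcal{O}}A$ and $LA:=L\otimes_{\mathcal{O}}A$ (via $\theta$). Assume that $KA$ is split semisimple and that $A$ is symmetric with symmetrizing form $t$. For any simple $KA$-module $V$, let $s_V\in\mathcal{O}$ be the Schur element of $V$ with respect to the induced symmetrizing form $t^K$ on $KA$. If $\mathrm{Ker}\,\theta$ is a prime ideal of $\mathcal{O}$ of height $1$, then $LA$ is split semisimple if and only if $\theta(s_V)\neq 0$ for all simple $KA$-modules $V$.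
   Context: A Krull ring is an integral domain $\mathcal{O}$ whose field of fractions $F$ carries a family $(v_i)_{i\in I}$ of discrete valuations such that $\mathcal{O}$ is the intersection of the valuation rings of the $v_i$ and, for every $x\in F^\times$, $v_i(x)\neq 0$ for only finitely many $i$. A symmetrizing form on an $\mathcal{O}$-algebra $A$ (free of finite rank as an $\mathcal{O}$-module) is an $\mathcal{O}$-linear map $t:A\to\mathcal{O}$ with $t(ab)=t(ba)$ for all $a,b\in A$ such that $a\mapsto(x\mapsto t(ax))$ is an isomorphism $A\to\mathrm{Hom}_{\mathcal{O}}(A,\mathcal{O})$; $A$ is then called symmetric. It extends to a symmetrizing form $t^K$ on $KA$. An algebra over a field $k$ is split if $\mathrm{End}(V)\cong k$ for every simple module $V$. Schur elements: let $V$ be a simple $KA$-module with character $\chi$. Let $\chi^\vee$ be the element of the center $Z(KA)$ with $t^K(\chi^\vee a)=\chi(a)$ for all $a\in KA$, and let $\omega_\chi:Z(KA)\to K$ be the central character, giving the scalar by which central elements act on $V$. The Schur element is $s_V:=\omega_\chi(\chi^\vee)$. It belongs to the integral closure of $\mathcal{O}$ in $K$, which is $\mathcal{O}$ since Krull rings are integrally closed. *)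

(* Defs.v *)
From HB Require Import structures.
From mathcomp Require Import all_boot all_order all_algebra.
From mathcomp Require Import classical_sets cardinality.
Set Implicit Arguments.
Unset Strict Implicit.
Unset Printing Implicit Defensive.
Import Order.TTheory GRing.Theory Num.Theory.
Local Open Scope ring_scope.

Notation "x %:F" := (@FracField.tofrac _ x) : ring_scope.

(* Only the values at nonzero arguments matter: v 0 = +oo is not represented,
   and v 0 : int is junk.  The value group is normalized to be int. *)
Record discrete_valuation (F : fieldType) (v : F -> int) : Prop := {
  dvalM : forall x y, x != 0 -> y != 0 -> v (x * y) = v x + v y;
  dvalD : forall x y, x != 0 -> y != 0 -> x + y != 0 ->
    Num.min (v x) (v y) <= v (x + y);
  dval_onto : exists2 x, x != 0 & v x = 1 }.

Definition krull_ring (O : idomainType) : Prop :=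
  exists (I : Type) (v : I -> {fraction O} -> int),
    [/\ forall i, discrete_valuation (v i),
        forall x, (exists a : O, x = a%:F) <->
                  (forall i, x = 0 \/ 0 <= v i x)
      & forall x, x != 0 -> finite_set [set i | v i x != 0]%classic].

Definition prime_ideal (R : comNzRingType) (P : {pred R}) : Prop :=
  idealr_closed P /\ prime_idealr_closed P.

Definition prime_chain (R : comNzRingType) (P : {pred R}) (n : nat) : Prop :=
  exists Q : nat -> {pred R},
    [/\ forall i, (i <= n)%N -> prime_ideal (Q i),
        forall i, (i < n)%N -> {subset Q i <= Q i.+1} /\
                               exists2 x, x \in Q i.+1 & x \notin Q i
      & Q n =i P].

Definition has_height (R : comNzRingType) (P : {pred R}) (n : nat) : Prop :=
  prime_chain P n /\ forall m, prime_chain P m -> (m <= n)%N.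

Definition ker_pred (R S : nzRingType) (theta : {rmorphism R -> S}) :
  {pred R} := [pred x | theta x == 0].

Definition is_basis (R : nzRingType) (V : lmodType R) (n : nat)
    (b : 'I_n -> V) : Prop :=
  forall x, exists! c : 'rV[R]_n, x = \sum_i c 0 i *: b i.

Definition free_of_finite_rank (R : nzRingType) (V : lmodType R) : Prop :=
  exists (n : nat) (b : 'I_n -> V), is_basis b.

(* B, together with j : a |-> 1 (x) a, is the S-algebra S (x)_R A: it satisfies
   the universal property of extension of scalars along theta, and j is a ring
   morphism, which fixes the multiplication of B. *)
Definition is_base_change (R S : comNzRingType) (theta : {rmorphism R -> S})
    (A : algType R) (B : algType S)
    (j : {lrmorphism A -> B | theta \; *:%R}) : Prop :=
  forall (M : lmodType S) (f : {linear A -> M | theta \; *:%R}),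
    (exists g : {linear B -> M}, forall a, g (j a) = f a) /\
    (forall g h : {linear B -> M}, (forall a, g (j a) = f a) ->
       (forall a, h (j a) = f a) -> forall x, g x = h x).

(* The last two clauses say that a |-> (x |-> t (a * x)) is bijective from A
   onto Hom_R(A, R). *)
Definition symmetrizing_form (R : comNzRingType) (A : algType R)
    (t : {scalar A}) : Prop :=
  [/\ forall a b, t (a * b) = t (b * a),
      forall a b, (forall x, t (a * x) = t (b * x)) -> a = b
    & forall f : {scalar A}, exists a, forall x, f x = t (a * x)].

Definition simple_module (R : nzRingType) (V : lmodType R) : Prop :=
  (exists v : V, v != 0) /\
  forall S : {pred V}, submod_closed S ->
    (forall v, v \in S -> v = 0) \/ (forall v, v \in S).

Definition semisimple_module (R : nzRingType) (V : lmodType R) : Prop :=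
  forall S : {pred V}, submod_closed S ->
    exists T : {pred V},
      [/\ submod_closed T,
          forall v, v \in S -> v \in T -> v = 0
        & forall v, exists x y, [/\ x \in S, y \in T & v = x + y]].

Definition semisimple_algebra (k : fieldType) (B : algType k) : Prop :=
  semisimple_module (B^o : lmodType B).

(* The canonical map k -> End_B(V) is onto; it is injective because V != 0. *)
Definition split_algebra (k : fieldType) (B : algType k) : Prop :=
  forall V : lmodType B, simple_module V ->
    forall f : {linear V -> V}, exists c : k, forall v, f v = c%:A *: v.

Definition split_semisimple (k : fieldType) (B : algType k) : Prop :=
  split_algebra B /\ semisimple_algebra B.

(* The k-module underlying a module over a k-algebra. *)
Definition restrict_scalars (k : fieldType) (B : algType k) (V : lmodType B) :
  Type := V.

Section RestrictScalars.
Variables (k : fieldType) (B : algType k) (V : lmodType B).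
Let scale (c : k) (v : V) : V := c%:A *: v.

Let scale_A a b v : scale a (scale b v) = scale (a * b) v.
Proof. by rewrite /scale scalerA -scalerAl mul1r scalerA. Qed.

Let scale_1 : left_id 1 scale.
Proof. by move=> v; rewrite /scale !scale1r. Qed.

Let scale_Dr : right_distributive scale +%R.
Proof. by move=> a u v; rewrite /scale scalerDr. Qed.

Let scale_Dl v : {morph scale^~ v : a b / a + b}.
Proof. by move=> a b; rewrite /scale !scalerDl. Qed.

HB.instance Definition _ := GRing.Zmodule.on (restrict_scalars V).
HB.instance Definition _ :=
  GRing.Zmodule_isLmodule.Build k (restrict_scalars V)
    scale_A scale_1 scale_Dr scale_Dl.
End RestrictScalars.

(* chi a is the trace of v |-> a *: v, computed in some k-basis of V. *)
Definition is_character (k : fieldType) (B : algType k) (V : lmodType B)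
    (chi : B -> k) : Prop :=
  exists (n : nat) (b : 'I_n -> restrict_scalars V) (rho : B -> 'M[k]_n),
    [/\ is_basis (R := k) b,
        forall a j, a *: (b j : V) = \sum_i rho a i j *: b i
      & forall a, chi a = \tr (rho a)].

(* z is the dual chi^vee of the character chi of V with respect to t, and
   s = omega_chi z is the scalar by which it acts on V. *)
Definition is_schur_element (k : fieldType) (B : algType k) (t : {scalar B})
    (V : lmodType B) (s : k) : Prop :=
  exists (chi : B -> k) (z : B),
    [/\ is_character V chi,
        forall a, z * a = a * z,
        forall a, t (z * a) = chi a
      & forall v : V, z *: v = s%:A *: v].

(* Main.v *)
Require Import Defs.
From HB Require Import structures.
From mathcomp Require Import all_boot all_order all_algebra.
From mathcomp Require Import boolp classical_sets cardinality.
From mathcomp Require Import ring zify.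
Import Order.TTheory GRing.Theory Num.Theory.
Set Implicit Arguments.
Unset Strict Implicit.
Unset Printing Implicit Defensive.
Local Open Scope ring_scope.

(** Write P for the kernel of theta. Since P has height one, the localization of
    the Krull ring O at P is the ring of one of the valuations v that define O
    (krull_height_one). Over this discrete valuation ring every simple
    KA-module V has a basis in which A acts by integral matrices rho
    (integral_representation).

    The symmetrizing form turns the coefficient x |-> rho(x)_ij into an element
    e_ij of KA, and the Schur relations say that rho(e_ij) is s_V times a matrix
    unit; in particular e_ii x e_ii = s_V tK(e_ii x) e_ii, and the sum of the e_ii
    is chi^vee (schur_relations, coeff_dual_corner). As rho is integral on A, a
    multiple beta e_ii with beta outside P lies in A, so that these relations can
    be reduced along theta (schur_corners). The same computation at each of the
    valuations that define O shows that s_V lies in O.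

    Let u be the image in LA of beta e_ii. It satisfies
    u x u = theta(s_V) tL(u x) u, and tL(u) = theta(beta) is not zero. If
    theta(s_V) = 0, then LA u is a nonzero left ideal of square zero and LA is
    not semisimple (semisimple_nilpotent_corner).

    Conversely suppose that all theta(s_V) are nonzero. For each V the element
    beta (s_V - chi^vee) is central and kills V. A suitable finite product of such
    elements kills all of KA, since each factor can be chosen to kill a minimal
    left ideal that is left (annihilating_product). Reducing this product to LA,
    where each factor is a nonzero scalar modulo the elements u, shows that the
    ideal generated by the elements u contains 1. By the displayed relation and
    the nondegeneracy of tL, the left ideals LA u are simple and the corners u LA u
    are lines; hence LA is semisimple and split
    (primitive_generators_split_semisimple). *)

(** * Discrete valuations and Krull rings at a prime of height one *)

Section ValuationRing.
Variables (F : fieldType) (v : F -> int) (dv : discrete_valuation v).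

(** The proof argument lets the closure instance below be inferred from the
    predicate alone. *)
Definition vring of discrete_valuation v : {pred F} :=
  [pred x | (x == 0) || (0 <= v x)].

Lemma vringE x : (x \in vring dv) = (x == 0) || (0 <= v x).
Proof. by []. Qed.

Lemma dval1 : v 1 = 0.
Proof.
by apply: (addrI (v 1)); rewrite addr0 -(dvalM dv) ?oner_neq0 // mulr1.
Qed.

Lemma dvalN1 : v (-1) = 0.
Proof.
have n10 : -1 != 0 :> F by rewrite oppr_eq0 oner_neq0.
have /eqP := dvalM dv n10 n10.
by rewrite mulrNN mulr1 dval1 eq_sym -mulr2n mulrn_eq0 /= => /eqP.
Qed.

Lemma dvalV x : x != 0 -> v x^-1 = - v x.
Proof.
move=> x0; apply: (addrI (v x)).
by rewrite -(dvalM dv) ?invr_neq0 // divff // dval1 subrr.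
Qed.

Lemma dvalX x n : x != 0 -> v (x ^+ n) = n%:Z * v x.
Proof.
move=> x0; elim: n => [|n IHn]; first by rewrite expr0 dval1 mul0r.
rewrite exprS (dvalM dv) // ?expf_neq0 // IHn -[n.+1]add1n PoszD; ring.
Qed.

Lemma dvalXz x (m : int) : x != 0 -> v (x ^ m) = m * v x.
Proof.
by case: m => n x0; rewrite ?NegzE -?exprnN ?dvalV ?expf_neq0 ?dvalX // mulNr.
Qed.

Lemma vring_subring : subring_closed (vring dv).
Proof.
have vN x : x != 0 -> v (- x) = v x.
  move=> x0; rewrite -mulN1r (dvalM dv) ?dvalN1 ?add0r //.
  by rewrite oppr_eq0 oner_neq0.
split=> [|x y|x y]; rewrite !vringE; first by rewrite dval1 lexx orbT.
- have [->|x0] := eqVneq x 0.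
    rewrite sub0r oppr_eq0; have [//|y0] := eqVneq y 0.
    by rewrite vN.
  have [->|y0] := eqVneq y 0; first by rewrite subr0 (negPf x0).
  have [//|xy0] := eqVneq (x - y) 0; move=> /= vx vy.
  have := @dvalD _ _ dv x (- y) x0; rewrite oppr_eq0 vN // => /(_ y0 xy0).
  by apply: le_trans; rewrite le_min vx vy.
- have [->|x0] := eqVneq x 0; first by rewrite mul0r eqxx.
  have [->|y0] := eqVneq y 0; first by rewrite mulr0 eqxx.
  by move=> /= vx vy; rewrite (dvalM dv) // addr_ge0 ?orbT.
Qed.

Definition vmax_ideal of discrete_valuation v : {pred F} :=
  [pred x | (x == 0) || (0 < v x)].

Lemma vmax_idealE x : (x \in vmax_ideal dv) = (x == 0) || (0 < v x).
Proof. by []. Qed.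

Lemma vmax_ideal_idealr a x y : a \in vring dv ->
  x \in vmax_ideal dv -> y \in vmax_ideal dv -> a * x + y \in vmax_ideal dv.
Proof.
rewrite vringE !vmax_idealE.
have [->|a0] := eqVneq a 0; first by rewrite mul0r add0r.
have [->|x0] := eqVneq x 0; first by rewrite mulr0 add0r.
move=> /= va vx vy; have vax : 0 < v (a * x) by rewrite (dvalM dv) // ltr_wpDl.
case: eqVneq vy => [->|y0 /= vy]; first by rewrite addr0 vax orbT.
have [//|axy0] := eqVneq (a * x + y) 0; apply/orP; right.
have := @dvalD _ _ dv (a * x) y; rewrite mulf_neq0 // => /(_ isT y0 axy0).
by apply: lt_le_trans; rewrite lt_min vax vy.
Qed.

Lemma vmax_ideal_prime x y : x \in vring dv -> y \in vring dv ->
  x * y \in vmax_ideal dv -> (x \in vmax_ideal dv) || (y \in vmax_ideal dv).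
Proof.
rewrite !vringE !vmax_idealE mulf_eq0.
have [//|x0] := eqVneq x 0.
have [_ _ _ _|y0] := eqVneq y 0; first by rewrite orbT.
by rewrite (dvalM dv) //=; lia.
Qed.

HB.instance Definition _ := GRing.isSubringClosed.Build F (vring dv)
  vring_subring.

(** Every finitely generated ideal of the valuation ring is generated by one of
    its generators, namely one of least valuation. *)
Lemma vring_div_min n (c : 'I_n -> F) : (exists i, c i != 0) ->
  exists2 i, c i != 0 & forall j, c j / c i \in vring dv.
Proof.
case=> i0 ci0.
case: (@arg_minP _ _ _ i0 [pred i | c i != 0] (fun i => v (c i)) ci0).
move=> i /= ci0' mini.
exists i => // j; rewrite vringE; have [->|cj] := eqVneq (c j) 0.
  by rewrite mul0r eqxx.
by rewrite (dvalM dv) ?invr_neq0 // dvalV // subr_ge0 mini ?orbT.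
Qed.

End ValuationRing.

Lemma seq_argmin (T : eqType) (f : T -> rat) (s : seq T) x0 : x0 \in s ->
  exists2 x, x \in s & forall y, y \in s -> f x <= f y.
Proof.
elim: s x0 => [|a s IHs] x0 //= _.
have [->|[b sb]] : s = [::] \/ exists b, b \in s.
  by case: s {IHs} => [|b s]; [left | right; exists b; rewrite mem_head].
  by exists a => [|y]; rewrite inE // => /eqP ->.
have [x sx minx] := IHs b sb; case: (leP (f a) (f x)) => fax.
  exists a => [|y]; first exact: mem_head.
  by rewrite inE => /predU1P[-> //|/minx]; apply: le_trans.
exists x => [|y]; first by rewrite inE sx orbT.
by rewrite inE => /predU1P[->|/minx //]; apply: ltW.
Qed.

(** The type of indices carries no decidable equality; {classic I} provides one,
    so that the finite set can be listed. *)
Lemma finite_set_seq (I : Type) (X : set I) : finite_set X ->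
  exists s : seq {classic I}, forall i, X i -> i \in s.
Proof.
move=> finX.
have /(@finite_seqP {classic I})[s sE] : @finite_set {classic I} X by [].
by exists s => i; rewrite sE.
Qed.

Section KrullHeightOne.
Variables (O : idomainType) (P : {pred O}).
Local Notation K := {fraction O}.

Lemma frac_quotient (x : K) : exists a b : O, b != 0 /\ x = a%:F / b%:F.
Proof.
elim/quotW: x => r; exists (frac r).1, (frac r).2.
split; first exact: denom_ratioP.
have d0 : ((frac r).2)%:F != 0 by rewrite tofrac_eq0 denom_ratioP.
apply: (mulIf d0); rewrite divfK //.
rewrite -[_ * _]/(FracField.mul _ _) !piE; apply/eqmodP.
rewrite /= FracField.equivfE /FracField.mulf.
rewrite !numden_Ratio ?oner_neq0 ?mulf_neq0 ?oner_neq0 ?denom_ratioP //.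
by rewrite !mulr1 mulrC.
Qed.

Hypotheses (primeP : prime_ideal P) (heightP : has_height P 1).
Variables (I : Type) (v : I -> K -> int).
Hypotheses (dv : forall i, discrete_valuation (v i))
  (vO : forall x, (exists a : O, x = a%:F) <-> (forall i, x = 0 \/ 0 <= v i x))
  (vfin : forall x, x != 0 -> finite_set [set i | v i x != 0]%classic).

Let ge0 (a : O) i : a != 0 -> 0 <= v i a%:F.
Proof.
move=> a0; have /vO/(_ i)[/eqP|//] : exists b : O, a%:F = b%:F by exists a.
by rewrite tofrac_eq0 (negPf a0).
Qed.

Let mulP a b : a \notin P -> b \notin P -> a * b \notin P.
Proof.
move=> aP bP; apply/negP => /(proj2 primeP)/orP[]; exact/negP.
Qed.

Let P0 : 0 \in P. Proof. by case: primeP => [[]]. Qed.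

Let expP a n : a \notin P -> a ^+ n \notin P.
Proof.
move=> aP; elim: n => [|n IHn]; first by case: primeP => [[]].
by rewrite exprS mulP.
Qed.

Let nP0 a : a \notin P -> a != 0.
Proof. by apply: contraNneq => ->. Qed.

(* The elements of O of positive valuation form the center of v i on O. *)
Let center_sub i := forall a : O, a != 0 -> 0 < v i a%:F -> a \in P.

(* The center of v i is a nonzero prime ideal inside P, so it is P by minimality. *)
Let center_eq i : center_sub i -> forall a, a != 0 -> a \in P -> 0 < v i a%:F.
Proof.
move=> Ji a a0 aP; rewrite lt_neqAle ge0 // andbT eq_sym.
apply/negP => /eqP va0.
pose Q : {pred O} := [pred x | x%:F \in vmax_ideal (dv i)].
pose C n : {pred O} := if n is 0%N then pred1 0 else if n is 1%N then Q else P.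
suff /(proj2 heightP) : prime_chain P 2 by [].
have v1 : v i 1%:F = 0 by rewrite tofrac1 (dval1 (dv i)).
have QE (x : O) : (x \in Q) = (x == 0) || (0 < v i x%:F).
  by rewrite inE vmax_idealE tofrac_eq0.
have Ov (x : O) : x%:F \in vring (dv i).
  rewrite vringE tofrac_eq0; have [//|x0] := eqVneq x 0.
  by rewrite ge0.
have QP : {subset Q <= P}.
  move=> x; rewrite QE; have [->|x0 /=] := eqVneq x 0; first by rewrite P0.
  exact: Ji.
exists C; split=> // [[|[|[|//]]] _|[|[|//]] _ /=].
- split; first split=> [||b x y]; rewrite ?inE ?oner_neq0 //.
    by move=> /eqP -> /eqP ->; rewrite mulr0 addr0.
  by move=> x y; rewrite !inE mulf_eq0.
- split; [split|] => [|||x y].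
  + by rewrite QE eqxx.
  + by rewrite QE oner_eq0 v1.
  + move=> b x y xQ yQ; rewrite inE rmorphD rmorphM /=.
    exact: vmax_ideal_idealr (Ov b) xQ yQ.
  + by rewrite inE rmorphM /=; apply: vmax_ideal_prime (Ov x) (Ov y).
- exact: primeP.
- split; first by move=> x; rewrite inE => /eqP ->; rewrite QE eqxx.
  have [x x0 vx] := dval_onto (dv i).
  have [n [d [d0 xE]]] := frac_quotient x.
  have n0 : n != 0 by apply: contraNneq x0 => n0; rewrite xE n0 tofrac0 mul0r.
  exists n; last by rewrite inE.
  rewrite QE (negPf n0) /= (_ : n%:F = x * d%:F); last first.
    by rewrite xE divfK // tofrac_eq0.
  by rewrite (dvalM (dv i)) ?tofrac_eq0 // vx ltr_wpDr ?ge0.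
- by split=> //; exists a => //; rewrite QE (negPf a0) va0.
Qed.

Let exists_pi : exists2 p, p != 0 & p \in P.
Proof.
have [[Q [prQ /(_ 0%N isT) [_ [x xQ xQ0]] QP]] _] := heightP.
exists x; last by rewrite -QP.
by apply: contraNneq xQ0 => ->; case: (prQ 0%N) => // [[]].
Qed.

(* Only finitely many v i are negative at x, and for each of them some c off P has
   positive valuation; multiplying x by powers of these c gives an element of O. *)
Let denominator_off x : (forall i, center_sub i -> x \in vring (dv i)) ->
  exists a b : O, b \notin P /\ x = a%:F / b%:F.
Proof.
have nP1 : 1 \notin P by case: primeP => [[]].
have [->|x0] := eqVneq x 0.
  by move=> _; exists 0, 1; split=> //; rewrite tofrac0 mul0r.
move=> xJ; have [s sP] := finite_set_seq (vfin x0).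
suff [b bP bx] : exists2 b : O, b \notin P &
    forall i, i \in s -> 0 <= v i (b%:F * x).
  have b0 := nP0 bP; have bF0 : b%:F != 0 :> K by rewrite tofrac_eq0.
  have /vO[a ax] i : b%:F * x = 0 \/ 0 <= v i (b%:F * x).
    right; case: (boolP (0 <= v i x)) => [vx|].
      by rewrite (dvalM (dv i)) // addr_ge0 ?ge0.
    rewrite -ltNge => vx; apply: bx; apply: sP => /=.
    by rewrite lt_eqF.
  by exists a, b; split=> //; rewrite -ax mulrC mulKf.
elim: s {sP} => [|i s [b bP IHs]]; first by exists 1.
have b0 := nP0 bP; have bF0 : b%:F != 0 :> K by rewrite tofrac_eq0.
have [vx|vx] := lerP 0 (v i x).
  exists b => // j; rewrite inE => /predU1P[->|/IHs //].
  by rewrite (dvalM (dv i)) // addr_ge0 ?ge0.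
have [c c0 [vc cP]] : exists2 c, c != 0 & 0 < v i c%:F /\ c \notin P.
  have /existsNP[c /not_implyP[c0 /not_implyP[vc /negP cP]]] : ~ center_sub i.
    move=> /xJ; rewrite vringE (negPf x0) leNgt vx //.
  by exists c.
have cF0 : c%:F != 0 :> K by rewrite tofrac_eq0.
pose m := `|v i x|%N.
exists (b * c ^+ m) => [|j]; first by rewrite mulP ?expP.
rewrite inE rmorphM rmorphXn /= => js.
have vcm k : 0 <= v k (c%:F ^+ m) by rewrite dvalX // mulr_ge0 ?ge0.
rewrite mulrAC (dvalM (dv j)) ?mulf_neq0 ?expf_neq0 //.
case/predU1P: js => [->|/IHs js]; last by rewrite addr_ge0.
rewrite (dvalM (dv i)) // dvalX // -addrA addr_ge0 ?ge0 //.
have : 1 * m%:Z <= m%:Z * v i c%:F by rewrite mulrC ler_wpM2l // -gtz0_ge1.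
rewrite /m; move: vx; lia.
Qed.

(** The valuations centered at P are finitely many, because they are all positive
    at a fixed nonzero p in P. Given x, let i1 minimize v_i(x) / v_i(p) among them.
    Then z = x ^ v_i1(p) * p ^ (- v_i1(x)) is integral at all of them and has
    valuation 0 at i1, so z is a quotient of two elements outside P and has
    valuation 0 at all of them. Hence v_i(x) / v_i(p) is independent of i: the
    valuations centered at P have the same ring, and this ring is the
    localization of O at P. *)
Lemma krull_height_one :
  exists v0 : K -> int, exists dv0 : discrete_valuation v0,
  (forall a : O, a%:F \in vring dv0) /\
  (forall x, x \in vring dv0 ->
     exists a b : O, b \notin P /\ x = a%:F / b%:F).
Proof.
have [p p0 pP] := exists_pi; have pF0 : p%:F != 0 :> K by rewrite tofrac_eq0.
have [s0 s0P] := finite_set_seq (vfin pF0).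
pose s : seq {classic I} := [seq i <- s0 | `[< center_sub i >]].
have sP (i : {classic I}) : (i \in s) <-> center_sub i.
  rewrite mem_filter; split=> [/andP[/asboolP]//|Ji]; rewrite asboolT //=.
  by apply: s0P; rewrite /= gt_eqF // center_eq.
have vp (i : {classic I}) : i \in s -> 0 < v i p%:F.
  by move/sP => Ji; apply: center_eq.
have [i0 si0] : exists i : {classic I}, i \in s.
  apply: contrapT => /forallNP nos.
  (* otherwise 1 / p would have a denominator off P *)
  have [|a [b [bP pE]]] := @denominator_off (p%:F)^-1 _.
    by move=> i /sP /nos.
  case/negP: bP; have b0 : b%:F != 0 :> K.
    by apply: contraNneq (invr_neq0 pF0) => b0; rewrite pE b0 invr0 mulr0.
  have -> : b = a * p + 0.
    rewrite addr0; apply/eqP; rewrite -tofrac_eq rmorphM /=; apply/eqP.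
    by rewrite -[a%:F](divfK b0) -pE mulrAC mulVf // mul1r.
  by have [[_ _ clP] _] := primeP; apply: clP.
have prop x (i j : {classic I}) : x != 0 -> i \in s -> j \in s ->
    v i x * v j p%:F = v j x * v i p%:F.
  move=> x0.
  have [i1 si1 mini] := @seq_argmin {classic I}
    (fun i : I => (v i x)%:~R / (v i p%:F)%:~R) _ _ si0.
  have {}mini (k : {classic I}) : k \in s ->
      v i1 x * v k p%:F <= v k x * v i1 p%:F.
    move=> sk; have := mini k sk; rewrite ler_pdivrMr ?ltr0z ?vp //.
    by rewrite mulrAC ler_pdivlMr ?ltr0z ?vp // -!intrM ler_int.
  suff eqi1 (k : {classic I}) : k \in s ->
      v i1 x * v k p%:F = v k x * v i1 p%:F.
    move=> si sj; have P0' : v i1 p%:F != 0 by rewrite gt_eqF ?vp.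
    by apply: (mulIf P0'); rewrite mulrAC -eqi1 // [RHS]mulrAC -eqi1 // mulrAC.
  move=> sk; pose z := x ^ (v i1 p%:F) * p%:F ^ (- v i1 x).
  have z0 : z != 0 by rewrite mulf_neq0 ?expfz_neq0.
  have vz (l : {classic I}) :
      v l z = v l x * v i1 p%:F - v i1 x * v l p%:F.
    by rewrite (dvalM (dv l)) ?expfz_neq0 // !dvalXz // mulNr; lia.
  have [|a [b [bP zE]]] := @denominator_off z.
    by move=> l /sP sl; rewrite vringE vz subr_ge0 mini ?orbT.
  have b0 := nP0 bP; have bF0 : b%:F != 0 :> K by rewrite tofrac_eq0.
  have a0 : a != 0 by apply: contraNneq z0 => a0; rewrite zE a0 tofrac0 mul0r.
  have aF0 : a%:F != 0 :> K by rewrite tofrac_eq0.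
  have vz' (l : {classic I}) : l \in s -> v l z = v l a%:F.
    move=> /sP Jl; rewrite zE (dvalM (dv l)) ?invr_neq0 // dvalV //.
    suff -> : v l b%:F = 0 by rewrite subr0.
    apply/eqP; rewrite eq_le ge0 // andbT leNgt; apply: contra bP; exact: Jl.
  have aP : a \notin P.
    apply/negP => /(center_eq (iffLR (sP _) si1) a0).
    by rewrite -vz' // vz subrr.
  apply/esym/eqP; rewrite -subr_eq0 -vz vz' // eq_le ge0 // andbT leNgt.
  by apply: contra aP; apply: (iffLR (sP _) sk).
exists (v i0), (dv i0); split=> [a|x].
  rewrite vringE tofrac_eq0; have [//|a0] := eqVneq a 0; exact: ge0.
have [->|x0] := eqVneq x 0.
  by move=> _; apply: denominator_off => i _; apply: rpred0.
rewrite vringE (negPf x0) /= => vx; apply: denominator_off => i /sP si.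
rewrite vringE (negPf x0) /=; have := prop x i i0 x0 si si0.
by rewrite -(pmulr_lge0 _ (vp _ si0)) => ->; rewrite mulr_ge0 // ltW ?vp.
Qed.
End KrullHeightOne.

(** * Lattices over a discrete valuation ring *)

Section Lattice.
Variables (F : fieldType) (v : F -> int) (dv : discrete_valuation v).
Variable V : lmodType F.

Definition in_lattice k (w : 'I_k -> V) (x : V) : Prop :=
  exists2 c : 'I_k -> F, forall i, c i \in vring dv & x = \sum_i c i *: w i.

Lemma in_lattice_gen k (w : 'I_k -> V) i : in_lattice w (w i).
Proof.
exists (fun j => (i == j)%:R) => [j|].
  by case: eqP; rewrite ?rpred0 ?rpred1.
rewrite (bigD1 i) //= eqxx scale1r big1 ?addr0 // => j.
rewrite eq_sym => /negPf ->.
by rewrite scale0r.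
Qed.

Lemma in_lattice_sum k (w : 'I_k -> V) n (a : 'I_n -> F) (x : 'I_n -> V) :
  (forall i, a i \in vring dv) -> (forall i, in_lattice w (x i)) ->
  in_lattice w (\sum_i a i *: x i).
Proof.
move=> aR xw; apply: (big_ind (in_lattice w)) => [|y z [c cR ->] [e eR ->]|i _].
- by exists (fun=> 0) => [i|]; rewrite ?rpred0 // big1 // => i; rewrite scale0r.
- exists (fun i => c i + e i) => [i|]; first exact: rpredD.
  by rewrite -big_split; apply: eq_bigr => i _; rewrite scalerDl.
- have [c cR ->] := xw i.
  exists (fun j => a i * c j) => [j|]; first exact: rpredM.
  by rewrite scaler_sumr; apply: eq_bigr => j _; rewrite scalerA.
Qed.

Lemma in_lattice_trans k l (w : 'I_k -> V) (b : 'I_l -> V) x :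
  (forall i, in_lattice b (w i)) -> in_lattice w x -> in_lattice b x.
Proof. by move=> wb [c cR ->]; apply: in_lattice_sum. Qed.

(** A finitely generated lattice over a discrete valuation ring has a basis
    among its generators: in a linear relation, the generator whose coefficient
    has least valuation is an integral combination of the others. *)
Lemma lattice_basis k (w : 'I_k -> V) : exists d (b : 'I_d -> V),
  [/\ forall c : 'I_d -> F, \sum_i c i *: b i = 0 -> forall i, c i = 0,
      forall i, in_lattice b (w i) & forall j, in_lattice w (b j)].
Proof.
elim: k w => [|k IHk] w; first by exists 0%N, w; split=> [c _ []|[]|[]].
have [wfree|] := pselect (forall c : 'I_k.+1 -> F,
    \sum_i c i *: w i = 0 -> forall i, c i = 0).
  by exists k.+1, w; split=> // i; apply: in_lattice_gen.
move=> /existsNP[c /not_implyP[cw0 /existsNP[i0 /eqP ci0]]].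
have [i ci cR] := @vring_div_min _ _ dv _ c (ex_intro _ i0 ci0).
have wi : w i = \sum_j (- (c (lift i j) / c i)) *: w (lift i j).
  apply: (scalerI ci); rewrite scaler_sumr; apply/eqP.
  rewrite -subr_eq0 -sumrN -[X in _ == X]cw0 (bigD1_ord i) //=.
  apply/eqP; congr (_ + _); apply: eq_bigr => j _.
  by rewrite scalerA mulrN scaleNr opprK mulrC divfK.
have [d [b [bfree wb bw]]] := IHk (fun j => w (lift i j)).
have w'w j : in_lattice w (w (lift i j)) by apply: in_lattice_gen.
exists d, b; split=> // [j|j]; last exact: in_lattice_trans (bw j).
case: (unliftP i j) => [j' ->|->]; first exact: wb.
by rewrite wi; apply: in_lattice_sum => // j'; rewrite rpredN.
Qed.

Lemma free_spanning_basis d (b : 'I_d -> V) :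
  (forall c : 'I_d -> F, \sum_i c i *: b i = 0 -> forall i, c i = 0) ->
  (forall x, exists c : 'I_d -> F, x = \sum_i c i *: b i) -> is_basis b.
Proof.
move=> bfree bspan x; have [c xE] := bspan x.
exists (\row_i c i); split=> [|c' xE'].
  by rewrite xE; apply: eq_bigr => i _; rewrite mxE.
apply/rowP => i; rewrite mxE; apply/eqP; rewrite -subr_eq0; apply/eqP.
apply: (bfree (fun j => c j - c' 0 j)).
under eq_bigr do rewrite scalerBl.
by rewrite sumrB -xE -xE' subrr.
Qed.

End Lattice.

(** * Dual bases and extension of scalars *)

(** The reproducing identity, rather than the orthogonality of b and d, is what
    extension of scalars preserves without any mention of linear independence. *)
Definition dual_bases (R : comNzRingType) (B : algType R) (tau : {scalar B})
    n (b d : 'I_n -> B) : Prop :=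
  (forall x y, tau (x * y) = tau (y * x)) /\
  (forall x, x = \sum_m tau (d m * x) *: b m).

(** This makes the inverse of y |-> (x |-> tau (y * x)) explicit. *)
Lemma dual_bases_repr (R : comNzRingType) (B : algType R) (tau : {scalar B})
    n (b d : 'I_n -> B) (f : {scalar B}) x :
  dual_bases tau b d -> tau ((\sum_m f (b m) *: d m) * x) = f x.
Proof.
case=> _ xE; rewrite mulr_suml linear_sum [in RHS](xE x) linear_sum /=.
apply: eq_bigr => m _.
by rewrite -scalerAl !linearZ /= mulrC.
Qed.

Lemma dual_bases_nondegenerate (R : comNzRingType) (B : algType R)
    (tau : {scalar B}) n (b d : 'I_n -> B) y z :
  dual_bases tau b d -> (forall x, tau (y * x) = tau (z * x)) -> y = z.
Proof.
case=> tauC xE yz; rewrite (xE y) (xE z); apply: eq_bigr => m _.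
by rewrite tauC yz tauC.
Qed.

(** The element d m represents the m-th coordinate form of a basis b. *)
Lemma symmetrizing_dual_bases (R : comNzRingType) (A : algType R)
    (t : {scalar A}) : free_of_finite_rank A -> symmetrizing_form t ->
  exists n (b d : 'I_n -> A), dual_bases t b d.
Proof.
move=> [n [b bP]] [tC _ trepr]; exists n, b.
have [co coP] := choice bP.
have coE x : x = \sum_i co x 0 i *: b i by case: (coP x).
have coU x (c : 'rV_n) : x = \sum_i c 0 i *: b i -> co x = c.
  by case: (coP x) => _; apply.
have co_lin m : scalar (fun x => co x 0 m).
  move=> a x y; suff -> : co (a *: x + y) = a *: co x + co y by rewrite !mxE.
  apply: coU; rewrite {1}(coE x) {1}(coE y) scaler_sumr -big_split /=.
  by apply: eq_bigr => i _; rewrite !mxE scalerDl scalerA.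
pose f m : {scalar A} := HB.pack (fun x : A => co x 0 m)
  (GRing.isLinear.Build _ _ _ _ _ (co_lin m)).
have /choice[d dP] m : exists d, forall x, co x 0 m = t (d * x) := trepr (f m).
exists d; split=> // x; rewrite {1}(coE x).
by apply: eq_bigr => i _; rewrite dP.
Qed.

Section BaseChange.
Variables (R S : comNzRingType) (theta : {rmorphism R -> S}).
Variables (A : algType R) (B : algType S).
Variable j : {lrmorphism A -> B | theta \; *:%R}.
Hypothesis jP : is_base_change j.

Lemma base_change_form (t : {scalar A}) :
  exists tS : {scalar B}, forall a, tS (j a) = theta (t a).
Proof.
have lin : linear_for (theta \; *:%R) (fun a => theta (t a) : S^o).
  by move=> c x y; rewrite linearP rmorphD rmorphM.
pose f : {linear A -> S^o | theta \; *:%R} :=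
  HB.pack (fun a : A => theta (t a) : S^o) (GRing.isLinear.Build _ _ _ _ _ lin).
by have [[g gP] _] := jP f; exists g.
Qed.

Variables (t : {scalar A}) (n : nat) (b d : 'I_n -> A).
Hypothesis bd : dual_bases t b d.
Variable tS : {scalar B}.
Hypothesis tSj : forall a, tS (j a) = theta (t a).

(** Both sides of the reproducing identity are linear in x and agree on the image
    of j, so the uniqueness part of the universal property identifies them. *)
Lemma base_change_dual_bases :
  dual_bases tS (fun m => j (b m)) (fun m => j (d m)).
Proof.
have [tC aE] := bd.
pose e x := \sum_m tS (j (d m) * x) *: j (b m).
have e_lin : linear e.
  move=> c x y; rewrite /e scaler_sumr -big_split; apply: eq_bigr => m _ /=.
  by rewrite mulrDr -scalerAr linearP scalerDl scalerA.
pose g : {linear B -> B} := HB.pack e (GRing.isLinear.Build _ _ _ _ _ e_lin).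
have xE x : x = e x.
  have [_ /(_ idfun g)] := jP j; apply=> // a; rewrite /= /e {2}(aE a) linear_sum.
  by apply: eq_bigr => m _; rewrite -rmorphM tSj linearZ.
have tSjC x a : tS (x * j a) = tS (j a * x).
  rewrite (xE x) /e mulr_suml mulr_sumr !linear_sum.
  apply: eq_bigr => m _; rewrite -scalerAl -scalerAr !linearZ -!rmorphM.
  by rewrite !tSj tC.
split=> // x y; rewrite (xE y) /e mulr_suml mulr_sumr !linear_sum.
by apply: eq_bigr => m _; rewrite -scalerAl -scalerAr !linearZ /= tSjC.
Qed.

(** The elements of A are separated by the forms t (_ * a), and the values of these
    forms survive in S. *)
Lemma base_change_inj : injective theta -> injective j.
Proof.
move=> theta_inj x y jxy; apply: (dual_bases_nondegenerate bd) => a.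
by apply: theta_inj; rewrite -!tSj !rmorphM /= jxy.
Qed.

End BaseChange.

(** * Matrix representations of modules *)

Lemma eq_mulmx_col (R : pzRingType) m n (M N : 'M[R]_(m, n)) :
  (forall c : 'cV_n, M *m c = N *m c) -> M = N.
Proof.
move=> MN; apply/matrixP => i j.
by have /colP/(_ i) := MN (delta_mx j 0); rewrite -!colE !mxE.
Qed.

(** The multiples of v0 form a nonzero submodule. *)
Lemma simple_module_cyclic (R : nzRingType) (V : lmodType R) (v0 : V) :
  simple_module V -> v0 != 0 -> forall v : V, exists a, v = a *: v0.
Proof.
move=> simpleV v00; pose S : {pred V} := [pred v | `[< exists a, v = a *: v0 >]].
have [|S0|SV] := proj2 simpleV S.
- split=> [|a x y /asboolP[c ->] /asboolP[c' ->]].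
    by apply/asboolP; exists 0; rewrite scale0r.
  by apply/asboolP; exists (a * c + c'); rewrite scalerDl scalerA.
- suff v0S : v0 \in S by rewrite (S0 _ v0S) eqxx in v00.
  by apply/asboolP; exists 1; rewrite scale1r.
- by move=> v; apply/asboolP/SV.
Qed.

Section MatrixRepresentation.
Variables (k : fieldType) (B : algType k) (V : lmodType B).

Lemma restrict_scaleE (c : k) (v : restrict_scalars V) :
  c *: v = c%:A *: (v : V).
Proof. by []. Qed.

Definition vec_of e (w : 'I_e -> restrict_scalars V) (c : 'cV[k]_e) :
  restrict_scalars V := \sum_i c i 0 *: w i.

Lemma vec_of_linear e (w : 'I_e -> restrict_scalars V) : linear (vec_of w).
Proof.
move=> a c c'; rewrite /vec_of scaler_sumr -big_split; apply: eq_bigr => i _ /=.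
by rewrite !mxE scalerDl scalerA.
Qed.

HB.instance Definition _ e (w : 'I_e -> restrict_scalars V) :=
  GRing.isLinear.Build k 'cV[k]_e (restrict_scalars V) _ (vec_of w)
    (vec_of_linear w).

Lemma vec_of_inj e (w : 'I_e -> restrict_scalars V) :
  is_basis (R := k) w -> injective (vec_of w).
Proof.
move=> wP c c' cc'; have [x [_ xU]] := wP (vec_of w c).
have xE (y : 'cV_e) : vec_of w y = vec_of w c -> x = y^T.
  by move=> yc; apply: xU; rewrite -yc; apply: eq_bigr => i _; rewrite mxE.
by apply: trmx_inj; rewrite -!xE.
Qed.

Lemma vec_of_surj e (w : 'I_e -> restrict_scalars V) :
  is_basis (R := k) w -> forall v, exists c, v = vec_of w c.
Proof.
move=> wP v; have [x [vE _]] := wP v.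
by exists x^T; rewrite vE; apply: eq_bigr => i _; rewrite mxE.
Qed.

Definition matrix_repr e (w : 'I_e -> restrict_scalars V) (rho : B -> 'M[k]_e) :
  Prop := forall a j, a *: (w j : V) = \sum_i rho a i j *: w i.

Lemma exists_matrix_repr e (w : 'I_e -> restrict_scalars V) :
  is_basis (R := k) w -> exists rho, matrix_repr w rho.
Proof.
move=> wP; have /choice[f fP] := vec_of_surj wP.
exists (fun a => \matrix_(i, j) f (a *: (w j : V)) i 0) => a j.
by rewrite {1}(fP (a *: (w j : V))); apply: eq_bigr => i _; rewrite mxE.
Qed.

Section Basis.
Variables (e : nat) (w : 'I_e -> restrict_scalars V) (rho : B -> 'M[k]_e).
Hypotheses (wP : is_basis (R := k) w) (rhoP : matrix_repr w rho).

Lemma vec_of_act a c : a *: (vec_of w c : V) = vec_of w (rho a *m c).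
Proof.
rewrite /vec_of scaler_sumr.
under [RHS]eq_bigr do rewrite mxE scaler_suml.
rewrite exchange_big; apply: eq_bigr => j _ /=.
rewrite restrict_scaleE scalerA mulr_algr -mulr_algl -scalerA rhoP scaler_sumr.
apply: eq_bigr => i _.
by rewrite !restrict_scaleE scalerA mulr_algl scalerA mulrC.
Qed.

Lemma repr_eq a M : (forall c, a *: (vec_of w c : V) = vec_of w (M *m c)) ->
  rho a = M.
Proof.
move=> aM; apply: eq_mulmx_col => c; apply: (vec_of_inj wP).
by rewrite -aM vec_of_act.
Qed.

Lemma reprM a b : rho (a * b) = rho a *m rho b.
Proof. by apply: repr_eq => c; rewrite -scalerA !vec_of_act mulmxA. Qed.

Lemma repr1 : rho 1 = 1%:M.
Proof. by apply: repr_eq => c; rewrite scale1r mul1mx. Qed.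

Lemma repr_linear : linear rho.
Proof.
move=> c a b; apply: repr_eq => x.
rewrite scalerDl -mulr_algl -scalerA -restrict_scaleE !vec_of_act.
by rewrite mulmxDl linearD -scalemxAl linearZ.
Qed.

Lemma repr_lincomb (I : finType) (c : I -> k) (x : I -> B) i j :
  rho (\sum_p c p *: x p) i j = \sum_p c p * rho (x p) i j.
Proof.
have rho0 : rho 0 = 0 by have := repr_linear (-1) 1 1; rewrite !scaleN1r !addNr.
elim/big_rec2: _ => [|p y z _ <-]; first by rewrite rho0 mxE.
by rewrite repr_linear !mxE.
Qed.

(** A matrix commuting with the representation is the matrix of an endomorphism
    of V, and splitness makes it scalar. *)
Lemma repr_commutant X :
  (forall f : {linear V -> V}, exists c : k, forall v, f v = c%:A *: v) ->
  (forall a, rho a *m X = X *m rho a) -> exists c, X = c%:M.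
Proof.
move=> splitV comX; have [co coP] := choice (vec_of_surj wP).
have coU c : co (vec_of w c) = c by apply: (vec_of_inj wP).
pose f (v : V) : V := vec_of w (X *m co v).
have f_lin : linear f.
  move=> a u v; rewrite /f vec_of_act mulmxA comX -mulmxA -linearD -mulmxDr.
  congr (vec_of w (X *m _)); apply: (vec_of_inj wP).
  by rewrite linearD /= -vec_of_act -!coP.
pose g : {linear V -> V} := HB.pack f (GRing.isLinear.Build _ _ _ _ _ f_lin).
have [c cP] := splitV g; exists c; apply: eq_mulmx_col => x.
apply: (vec_of_inj wP); rewrite mul_scalar_mx linearZ /=.
by have := cP (vec_of w x); rewrite /= /f coU.
Qed.

End Basis.

(** The changes of basis P and Q are rectangular a priori, and the cyclicity of the
    trace applies to them as such: the two dimensions need not be compared. *)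
Lemma trace_repr e e' (w : 'I_e -> restrict_scalars V) (rho : B -> 'M[k]_e)
    (w' : 'I_e' -> restrict_scalars V) (rho' : B -> 'M[k]_e') :
  is_basis (R := k) w -> matrix_repr w rho ->
  is_basis (R := k) w' -> matrix_repr w' rho' ->
  forall a, \tr (rho a) = \tr (rho' a).
Proof.
move=> wP rhoP wP' rhoP' a.
have change m m' (u : 'I_m -> restrict_scalars V)
    (u' : 'I_m' -> restrict_scalars V) :
    is_basis (R := k) u -> exists P, forall c, vec_of u' c = vec_of u (P *m c).
  move=> uP; have [f fP] := choice (fun j => vec_of_surj uP (u' j)).
  exists (\matrix_(i, j) f j i 0) => c; rewrite {1}/vec_of.
  rewrite [in RHS](matrix_sum_delta c) mulmx_sumr linear_sum.
  apply: eq_bigr => j _; rewrite big_ord1 -scalemxAr linearZ /= -colE [u' j]fP.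
  by congr (_ *: vec_of u _); apply/colP => i; rewrite !mxE.
have [P PE] := change _ _ w w' wP; have [Q QE] := change _ _ w' w wP'.
have PQ : P *m Q = 1%:M.
  apply: eq_mulmx_col => c; apply: (vec_of_inj wP).
  by rewrite -mulmxA -PE -QE mul1mx.
have QP : Q *m P = 1%:M.
  apply: eq_mulmx_col => c; apply: (vec_of_inj wP').
  by rewrite -mulmxA -QE -PE mul1mx.
have rhoPE : rho a *m P = P *m rho' a.
  apply: eq_mulmx_col => c; apply: (vec_of_inj wP).
  by rewrite -!mulmxA -(vec_of_act rhoP) -!PE (vec_of_act rhoP').
by rewrite -[rho a]mulmx1 -PQ mulmxA rhoPE mxtrace_mulC mulmxA QP mul1mx.
Qed.

End MatrixRepresentation.

(** * Schur relations and Schur elements *)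

Section SchurElement.
Variables (k : fieldType) (B : algType k) (tau : {scalar B}).
Variables (n : nat) (b d : 'I_n -> B) (bd : dual_bases tau b d).
Variables (V : lmodType B).
Hypothesis splitV :
  forall f : {linear V -> V}, exists c : k, forall v, f v = c%:A *: v.
Variables (e : nat) (w : 'I_e -> restrict_scalars V) (rho : B -> 'M[k]_e).
Hypotheses (wP : is_basis (R := k) w) (rhoP : matrix_repr w rho).

(** The element of B that represents the coefficient (i, j) of rho with respect to
    tau. Up to a scalar, it will act on V as the matrix unit (j, i). *)
Definition coeff_dual i j : B := \sum_m rho (b m) i j *: d m.

Lemma coeff_dualP i j x : tau (coeff_dual i j * x) = rho x i j.
Proof.
have lin : scalar (fun x => rho x i j).
  by move=> c y z; rewrite (repr_linear wP rhoP) !mxE.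
pose f : {scalar B} := HB.pack (fun x : B => rho x i j)
  (GRing.isLinear.Build _ _ _ _ _ lin).
exact: (dual_bases_repr f).
Qed.

Let nondeg y z := @dual_bases_nondegenerate _ _ _ _ _ _ y z bd.
Let tauC : forall x y, tau (x * y) = tau (y * x) := proj1 bd.
Let rhoM := reprM wP rhoP.

Lemma coeff_dual_mulr i j a :
  coeff_dual i j * a = \sum_p rho a i p *: coeff_dual p j.
Proof.
apply: nondeg => x; rewrite -mulrA coeff_dualP rhoM mxE mulr_suml linear_sum.
by apply: eq_bigr => p _; rewrite -scalerAl linearZ /= coeff_dualP.
Qed.

Lemma coeff_dual_mull i j a :
  a * coeff_dual i j = \sum_p rho a p j *: coeff_dual i p.
Proof.
apply: nondeg => x; rewrite tauC mulrA tauC coeff_dualP rhoM mxE mulr_suml.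
rewrite linear_sum.
by apply: eq_bigr => p _; rewrite -scalerAl linearZ /= coeff_dualP mulrC.
Qed.

(** For fixed i and q, the matrix with entries rho(coeff_dual i j)_pq, indexed by p
    and j, commutes with rho: this is coeff_dual_mull. For fixed p and j, so does
    the matrix indexed by i and q, by coeff_dual_mulr. Both are therefore scalar,
    and comparing the two families leaves a single constant s. *)
Lemma schur_relations : exists s, forall i j p q,
  rho (coeff_dual i j) p q = s *+ ((p == j) && (i == q)).
Proof.
have colP' i q : exists c, forall p j, rho (coeff_dual i j) p q = c *+ (p == j).
  pose X := \matrix_(p, j) rho (coeff_dual i j) p q.
  have [|c XE] := @repr_commutant _ _ _ _ _ _ wP rhoP X splitV.
    move=> a; apply/matrixP => p j; rewrite [LHS]mxE [RHS]mxE.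
    transitivity (rho (a * coeff_dual i j) p q).
      by rewrite rhoM mxE; apply: eq_bigr => r _; rewrite mxE.
    rewrite coeff_dual_mull (repr_lincomb wP rhoP).
    by apply: eq_bigr => r _; rewrite mxE mulrC.
  by exists c => p j; have /matrixP/(_ p j) := XE; rewrite !mxE.
have rowP' p j : exists c, forall i q, rho (coeff_dual i j) p q = c *+ (i == q).
  pose Y := \matrix_(i, q) rho (coeff_dual i j) p q.
  have [|c YE] := @repr_commutant _ _ _ _ _ _ wP rhoP Y splitV.
    move=> a; apply/matrixP => i q; rewrite [LHS]mxE [RHS]mxE.
    transitivity (rho (coeff_dual i j * a) p q).
      rewrite coeff_dual_mulr (repr_lincomb wP rhoP).
      by apply: eq_bigr => r _; rewrite mxE.
    by rewrite rhoM mxE; apply: eq_bigr => r _; rewrite mxE.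
  by exists c => i q; have /matrixP/(_ i q) := YE; rewrite !mxE.
have [e0|/card_gt0P[i0 _]] := posnP #|'I_e|.
  by exists 0 => i; have := card0_eq e0 i; rewrite inE.
exists (rho (coeff_dual i0 i0) i0 i0) => i j p q.
have [c cE] := colP' i q; have [c' c'E] := rowP' p j.
have [pj|pj] := eqVneq p j; last by rewrite cE (negPf pj).
have [iq|iq] := eqVneq i q; last by rewrite c'E (negPf iq).
rewrite -pj -iq; have [c1 c1E] := rowP' p p; have [c2 c2E] := colP' i0 i0.
by rewrite c1E !eqxx; have := c1E i0 i0; rewrite !c2E !eqxx => ->.
Qed.

Variable s : k.
Hypothesis sP : forall i j p q,
  rho (coeff_dual i j) p q = s *+ ((p == j) && (i == q)).

(** If s is invertible, then coeff_dual i i is a multiple of a primitive idempotent;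
    if s vanishes, it generates a left ideal of square zero. The relation keeps a
    meaning after reduction, where either case can occur. *)
Lemma coeff_dual_corner i a :
  coeff_dual i i * a * coeff_dual i i = (s * rho a i i) *: coeff_dual i i.
Proof.
rewrite -mulrA coeff_dual_mulr (bigD1 i) //= big1 ?addr0 => [|p pi].
  congr (_ *: _); rewrite rhoM mxE (bigD1 i) //= big1 ?addr0 => [|p pi].
    by rewrite sP !eqxx mulrC.
  by rewrite sP (negPf pi) mulr0.
rewrite rhoM mxE big1 ?scale0r // => q _.
by rewrite sP [i == p]eq_sym (negPf pi) andbF mulr0.
Qed.

(** This is chi^vee, for chi the trace of rho. *)
Definition char_dual : B := \sum_i coeff_dual i i.

Lemma char_dualP x : tau (char_dual * x) = \tr (rho x).
Proof.
by rewrite mulr_suml linear_sum; apply: eq_bigr => i _; apply: coeff_dualP.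
Qed.

Lemma char_dual_central a : char_dual * a = a * char_dual.
Proof.
apply: nondeg => x.
rewrite -mulrA char_dualP [in RHS]tauC mulrA tauC char_dualP.
by rewrite !rhoM mxtrace_mulC.
Qed.

Lemma repr_char_dual : rho char_dual = s%:M.
Proof.
apply/matrixP => p q; rewrite /char_dual.
under eq_bigr do rewrite -[coeff_dual _ _]scale1r.
rewrite (repr_lincomb wP rhoP) mxE (bigD1 p) //= big1 ?addr0 => [|i pi].
  by rewrite mul1r sP eqxx.
by rewrite mul1r sP eq_sym (negPf pi).
Qed.

Lemma char_dual_act (v : V) : char_dual *: v = s%:A *: v.
Proof.
have [c ->] := vec_of_surj wP v.
by rewrite (vec_of_act rhoP) repr_char_dual mul_scalar_mx linearZ.
Qed.

Lemma char_dual_sqr : char_dual * char_dual = s *: char_dual.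
Proof.
apply: nondeg => x; rewrite -mulrA char_dualP rhoM repr_char_dual.
by rewrite -scalerAl linearZ /= char_dualP mul_scalar_mx linearZ.
Qed.

Lemma schur_elementP : is_schur_element tau V s.
Proof.
exists (fun a => \tr (rho a)), char_dual; split.
- by exists e, w, rho.
- exact: char_dual_central.
- exact: char_dualP.
- exact: char_dual_act.
Qed.

(** The character does not depend on the chosen basis and tau is nondegenerate, so
    there is only one chi^vee, and it acts on V by only one scalar. *)
Lemma schur_element_unique s' : (exists v : V, v != 0) ->
  is_schur_element tau V s' -> s' = s.
Proof.
case=> v v0 [chi [z [[e' [w' [rho' [wP' rhoP' chiE]]]] _ zE zv]]].
have zz : z = char_dual.
  apply: nondeg => x.
  by rewrite zE chiE char_dualP (trace_repr wP' rhoP' wP rhoP).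
have : (s - s') *: (v : restrict_scalars V) = 0.
  by rewrite scalerBl !restrict_scaleE -char_dual_act -zz zv subrr.
by move/eqP; rewrite scaler_eq0 subr_eq0 (negPf v0) orbF => /eqP.
Qed.

End SchurElement.

(** * Integral representations *)

Lemma common_denominator (O : idomainType) (P : {pred O}) (T : finType)
    (x : T -> {fraction O}) : prime_ideal P ->
  (forall i, exists a b : O, b \notin P /\ x i = a%:F / b%:F) ->
  exists2 beta : O, beta \notin P &
    forall i, exists g : O, beta%:F * x i = g%:F.
Proof.
move=> [[P0 P1 _] primeP] xP; have /choice[f fP] : forall i, exists q : O * O,
    q.2 \notin P /\ x i = q.1%:F / q.2%:F.
  by move=> i; have [a [b ?]] := xP i; exists (a, b).
exists (\prod_i (f i).2).
  apply: (big_ind (fun y => y \notin P)) => // [y z yP zP|i _].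
    by apply/negP => /primeP/orP[]; apply/negP.
  by case: (fP i).
move=> i; have [bP xE] := fP i.
have b0 : ((f i).2)%:F != 0 by rewrite tofrac_eq0; apply: contraNneq bP => ->.
exists ((f i).1 * \prod_(j | j != i) (f j).2).
by rewrite xE (bigD1 i) //= !rmorphM /= mulrAC mulrCA divff // mulr1 mulrC.
Qed.

Section IntegralRepresentation.
Variables (O : idomainType) (A : algType O).
Local Notation K := {fraction O}.
Variables (KA : algType K).
Variable jK : {lrmorphism A -> KA | @FracField.tofrac O \; *:%R}.
Variables (t : {scalar A}) (n : nat) (b d : 'I_n -> A) (bd : dual_bases t b d).
Variables (tK : {scalar KA}) (tKj : forall a, tK (jK a) = (t a)%:F).
Hypothesis jKP : is_base_change jK.

Let bdK : dual_bases tK (fun m => jK (b m)) (fun m => jK (d m)) :=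
  base_change_dual_bases jKP bd tKj.

Variables (V : lmodType KA) (simpleV : simple_module V).

(** Over the valuation ring, the vectors jK (b m) *: v0 generate a lattice that is
    stable under A, and this lattice spans V because V is simple. In a basis of the
    lattice, A acts by integral matrices. *)
Lemma integral_representation (v : K -> int) (dv : discrete_valuation v) :
  (forall a : O, a%:F \in vring dv) ->
  exists e (w : 'I_e -> restrict_scalars V) (rho : KA -> 'M[K]_e),
    [/\ (0 < e)%N, is_basis (R := K) w, matrix_repr w rho
      & forall a i j, rho (jK a) i j \in vring dv].
Proof.
move=> Ov; have [v0 v00] := proj1 simpleV.
pose u m : restrict_scalars V := jK (b m) *: v0.
have jK_scale c a (x : V) : jK (c *: a) *: x =
    c%:F *: (jK a *: x : restrict_scalars V).
  by rewrite linearZ /= -mulr_algl -scalerA.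
have [e [w [wfree uw wu]]] := lattice_basis dv u.
have spanw x : exists c : 'I_e -> K, x = \sum_i c i *: w i.
  have [a ->] := simple_module_cyclic simpleV v00 x.
  have /choice[c cE] m : exists c : 'I_e -> K, u m = \sum_i c i *: w i.
    by have [c _ cE] := uw m; exists c.
  exists (fun i => \sum_m tK (jK (d m) * a) * c m i).
  rewrite {1}[a](proj2 bdK) scaler_suml.
  under [RHS]eq_bigr do rewrite scaler_suml.
  rewrite exchange_big; apply: eq_bigr => m _ /=.
  under eq_bigr do rewrite -scalerA.
  by rewrite -scaler_sumr -cE -mulr_algl -scalerA.
have wP := free_spanning_basis wfree spanw.
have [rho rhoP] := exists_matrix_repr wP.
have stable a x : in_lattice dv u x -> in_lattice dv u (jK a *: (x : V)).
  case=> c cR ->; rewrite scaler_sumr.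
  have -> : \sum_i jK a *: (c i *: u i : V) =
      \sum_i c i *: (jK a *: (u i : V) : restrict_scalars V).
    apply: eq_bigr => i _.
    by rewrite !restrict_scaleE !scalerA mulr_algr mulr_algl.
  apply: in_lattice_sum => // m; rewrite /u scalerA -rmorphM.
  rewrite [a * b m](proj2 bd) rmorph_sum /= scaler_suml.
  exists (fun l => (t (d l * (a * b m)))%:F) => // .
  by apply: eq_bigr => l _; rewrite -jK_scale.
exists e, w, rho; split=> // [|a i j].
  case: e w {wfree uw wu wP rhoP rho} spanw => // w /(_ v0)[c v0E].
  by rewrite v0E big_ord0 eqxx in v00.
have [c cR cE] := in_lattice_trans uw (stable a _ (wu j)).
suff -> : rho (jK a) i j = c i by [].
apply/eqP; rewrite -subr_eq0; apply/eqP.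
apply: (wfree (fun i => rho (jK a) i j - c i)).
under eq_bigr do rewrite scalerBl.
by rewrite sumrB -cE -rhoP subrr.
Qed.

Hypothesis splitV :
  forall f : {linear V -> V}, exists c : K, forall v, f v = c%:A *: v.

(** In an integral representation, s is a matrix entry of coeff_dual i i, which is
    an integral combination of the elements jK (d m). *)
Lemma schur_element_integral (v : K -> int) (dv : discrete_valuation v) s :
  (forall a : O, a%:F \in vring dv) ->
  is_schur_element tK V s -> s \in vring dv.
Proof.
move=> Ov sV.
have [e [w [rho [e0 wP rhoP rhoR]]]] := integral_representation Ov.
have [s' s'P] := schur_relations bdK splitV wP rhoP.
have -> := schur_element_unique bdK wP rhoP s'P (proj1 simpleV) sV.
have := s'P (Ordinal e0) (Ordinal e0) (Ordinal e0) (Ordinal e0).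
rewrite !eqxx mulr1n => <-; rewrite (repr_lincomb wP rhoP).
by apply: rpred_sum => m _; apply: rpredM.
Qed.


(** The coefficients of coeff_dual i i on the elements jK (d m) are the entries
    rho (jK (b m)) i i, which are integral at v and so have a common denominator
    beta outside P. Thus eps i = beta coeff_dual i i lies in A, where the Schur
    relations can be reduced modulo P. *)
Lemma schur_corners (P : {pred O}) (v : K -> int) (dv : discrete_valuation v) :
  prime_ideal P -> (forall a : O, a%:F \in vring dv) ->
  (forall x, x \in vring dv ->
     exists x1 x2 : O, x2 \notin P /\ x = x1%:F / x2%:F) ->
  (forall s, is_schur_element tK V s -> exists a : O, s = a%:F) ->
  exists (s beta : O) e (eps : 'I_e -> A),
  [/\ is_schur_element tK V s%:F /\
        (forall s' : O, is_schur_element tK V s'%:F -> s' = s),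
      beta \notin P /\ (0 < e)%N,
      forall i, t (eps i) = beta,
      forall i a, eps i * a * eps i = (s * t (eps i * a)) *: eps i
    & let z := \sum_i eps i in
      [/\ forall x, jK z * x = x * jK z,
          forall u : V, jK z *: u = (beta * s)%:F%:A *: u
        & z * z = (beta * s) *: z]].
Proof.
move=> primeP Ov denP Os.
have [e [w [rho [e0 wP rhoP rhoR]]]] := integral_representation Ov.
have [s' s'P] := schur_relations bdK splitV wP rhoP.
have schurV := schur_elementP bdK wP rhoP s'P.
have uniqV := schur_element_unique bdK wP rhoP s'P (proj1 simpleV).
have [s sE] := Os _ schurV; rewrite {s'}sE in s'P schurV uniqV.
have [beta betaP gP] := common_denominator primeP
  (fun q : 'I_e * 'I_n => denP _ (rhoR (b q.2) q.1 q.1)).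
have /choice[g gE] := gP.
pose eps i := \sum_m g (i, m) *: d m.
pose E i := coeff_dual (fun m => jK (b m)) (fun m => jK (d m)) rho i i.
have jeps i : jK (eps i) = beta%:F *: E i.
  rewrite rmorph_sum scaler_sumr; apply: eq_bigr => m _ /=.
  by rewrite linearZ /= -gE scalerA.
have teps i a : (t (eps i * a))%:F = beta%:F * rho (jK a) i i.
  rewrite -tKj rmorphM /= jeps -scalerAl linearZ /=.
  by rewrite (coeff_dualP bdK wP rhoP).
have jinj : injective jK.
  by apply: (base_change_inj bd tKj) => x y /eqP; rewrite tofrac_eq => /eqP.
pose z := \sum_i eps i.
pose Z := char_dual (fun m => jK (b m)) (fun m => jK (d m)) rho.
have jz : jK z = beta%:F *: Z.
  by rewrite rmorph_sum scaler_sumr; apply: eq_bigr => i _; apply: jeps.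
exists s, beta, e, eps; split=> // [|i|i a|].
- by split=> // s1 /uniqV/eqP; rewrite tofrac_eq => /eqP.
- apply/eqP; rewrite -tofrac_eq -[eps i]mulr1 teps rmorph1 (repr1 wP rhoP).
  by rewrite mxE eqxx mulr1.
- apply: jinj; rewrite !rmorphM /= jeps linearZ /= jeps rmorphM /= teps.
  rewrite -!(scalerAl, scalerAr) (coeff_dual_corner bdK wP rhoP s'P) !scalerA.
  by congr (_ *: _); ring.
- split=> [x|u|].
  + by rewrite -/z jz -scalerAl -scalerAr (char_dual_central bdK wP rhoP).
  + rewrite -/z jz -[beta%:F *: Z]mulr_algl -scalerA.
    rewrite (char_dual_act wP rhoP s'P).
    by rewrite -!restrict_scaleE scalerA rmorphM.
  + apply: jinj; rewrite -/z rmorphM /= linearZ /= jz -scalerAl -scalerAr.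
    by rewrite (char_dual_sqr bdK wP rhoP s'P) !scalerA rmorphM mulrAC.
Qed.

End IntegralRepresentation.

(** * Algebras generated by primitive elements *)

(** The left ideal B u has square zero. Writing 1 = x + y along B u and a complement
    T gives u = u x + u y = u y, which lies in both B u and T. *)
Lemma semisimple_nilpotent_corner (k : fieldType) (B : algType k) (u : B) :
  semisimple_algebra B -> (forall x, u * x * u = 0) -> u = 0.
Proof.
move=> ssB uxu; pose S : {pred B^o} := [pred x | `[< exists a, x = a * u >]].
have [|T [[T0 Tlin] ST0 STB]] := ssB S.
  split=> [|a x y /asboolP[c ->] /asboolP[c' ->]]; apply/asboolP.
    by exists 0; rewrite mul0r.
  by exists (a * c + c'); rewrite mulrDl -mulrA.
have [x [y [/asboolP[a xE] yT E]]] := STB 1.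
apply: ST0; first by apply/asboolP; exists 1; rewrite mul1r.
suff -> : u = u *: (y : B^o) + 0 by apply: Tlin.
rewrite addr0; have := congr1 ( *%R u) E.
by rewrite mulr1 mulrDr xE mulrA uxu add0r.
Qed.

(** The two-sided ideal is presented inductively because the arguments below adjoin
    one left ideal B u c at a time. *)
Inductive ideal_generated (B : nzRingType) (U : B -> Prop) : B -> Prop :=
| IdealGenerated0 : ideal_generated U 0
| IdealGeneratedD a u c x : U u -> ideal_generated U x ->
    ideal_generated U (a * u * c + x).

Section IdealGenerated.
Variables (B : nzRingType) (U : B -> Prop).

Lemma ideal_generated_add x y :
  ideal_generated U x -> ideal_generated U y -> ideal_generated U (x + y).
Proof.
move=> Ux Uy; elim: Ux => [|a u c z Uu _ IH]; first by rewrite add0r.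
by rewrite -addrA; apply: IdealGeneratedD.
Qed.

Lemma ideal_generated_mull r x :
  ideal_generated U x -> ideal_generated U (r * x).
Proof.
elim=> [|a u c z Uu _ IH]; first by rewrite mulr0; left.
by rewrite mulrDr !mulrA; apply: IdealGeneratedD.
Qed.

Lemma ideal_generated_mulr r x :
  ideal_generated U x -> ideal_generated U (x * r).
Proof.
elim=> [|a u c z Uu _ IH]; first by rewrite mul0r; left.
by rewrite mulrDl -mulrA; apply: IdealGeneratedD.
Qed.

Lemma ideal_generated_gen u : U u -> ideal_generated U u.
Proof.
by move=> Uu; rewrite -[u]addr0 -[u]mulr1 -[u]mul1r; right => //; left.
Qed.
End IdealGenerated.

Inductive product_of (A : nzRingType) (H : A -> Prop) : A -> Prop :=
| ProductOf1 : product_of H 1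
| ProductOfM h a : H h -> product_of H a -> product_of H (h * a).

(** Modulo the ideal, each factor is a nonzero scalar, hence so is the product. *)
Lemma product_ideal_generated (k : fieldType) (A : nzRingType) (B : algType k)
    (phi : {rmorphism A -> B}) (H : A -> Prop) (U : B -> Prop) a :
  (forall h, H h -> exists2 g : k, g != 0 & ideal_generated U (phi h - g%:A)) ->
  product_of H a -> exists2 g : k, g != 0 & ideal_generated U (phi a - g%:A).
Proof.
move=> HU; elim=> [|h x Hh _ [g g0 gU]].
  by exists 1; rewrite ?oner_neq0 // rmorph1 scale1r subrr; left.
have [g' g'0 g'U] := HU h Hh; exists (g' * g); first exact: mulf_neq0.
have -> : phi (h * x) - (g' * g)%:A =
    (phi h - g'%:A) * phi x + g'%:A * (phi x - g%:A).
  by rewrite mulrBl mulrBr addrA subrK rmorphM mulr_algl scalerA.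
apply: ideal_generated_add; first exact: ideal_generated_mulr.
exact: ideal_generated_mull.
Qed.

Section PrimitiveGenerators.
Variables (k : fieldType) (B : algType k) (tau : {scalar B}).
Variables (n : nat) (b d : 'I_n -> B) (bd : dual_bases tau b d).
Variable U : B -> Prop.
Hypothesis UP : forall u, U u ->
  exists2 c, c != 0 & forall x, u * x * u = (c * tau (u * x)) *: u.
Hypothesis U1 : ideal_generated U 1.

(** By nondegeneracy some tau (x u a) is nonzero, and then u a x u is a nonzero
    multiple of u. So each left ideal B u y is zero or simple. *)
Lemma primitive_left_ideal u y x : U u -> x * (u * y) != 0 ->
  exists z, z * (x * (u * y)) = u * y.
Proof.
move=> Uu xuy; have [c c0 cE] := UP Uu.
have xu0 : x * u != 0 by apply: contraNneq xuy => xu; rewrite mulrA xu mul0r.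
have [a tau0] : exists a, tau (x * u * a) != 0.
  apply: contrapT => /forallNP xu; case/eqP: xu0.
  apply: (dual_bases_nondegenerate bd) => a; rewrite mul0r linear0.
  by apply/eqP; rewrite -[_ == _]negbK; apply/negP/xu.
pose e := c * tau (u * (a * x)).
have e0 : e != 0 by rewrite mulf_neq0 // mulrA (proj1 bd) mulrA.
exists (e^-1 *: (u * a)).
have -> : e^-1 *: (u * a) * (x * (u * y)) = e^-1 *: ((u * (a * x) * u) * y).
  by rewrite -scalerAl !mulrA.
by rewrite cE -!scalerAl scalerA mulVf // scale1r.
Qed.

(** A complement T of S is built greedily while 1 is written as a sum of elements
    a u c: the left ideal B u c is added to T, unless S + T contains a nonzero
    element of it and hence, by simplicity, all of it. *)
Lemma primitive_generators_semisimple : semisimple_algebra B.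
Proof.
move=> S [S0 Slin].
have Sadd (x y : B^o) : x \in S -> y \in S -> x + y \in S.
  by move=> xS yS; rewrite -[x]scale1r; apply: Slin.
have Sscale a (x : B^o) : x \in S -> a *: x \in S.
  by move=> xS; rewrite -[_ *: _]addr0; apply: Slin.
suff [T [Tsub ST0 [x [y [xS yT E]]]]] : exists T : {pred B^o},
    [/\ GRing.submod_closed T, forall v, v \in S -> v \in T -> v = 0
      & exists x y, [/\ x \in S, y \in T & 1 = x + y]].
  exists T; split=> // v; exists (v *: x), (v *: y); split; first exact: Sscale.
    by rewrite -[_ *: _]addr0; apply: (proj2 Tsub) => //; apply: (proj1 Tsub).
  by rewrite -scalerDr -E /GRing.scale /= mulr1.
elim: U1 => [|a u c z Uu _ [T [[T0 Tlin] ST0 [x [y [xS yT E]]]]]].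
  pose Z : {pred B^o} := [pred x | x == 0]; exists Z; split=> [|v _ /eqP //|].
    by split=> [|e v v' /eqP -> /eqP ->]; rewrite inE // scaler0 addr0.
  by exists 0, 0; rewrite addr0 inE.
have Tadd (v v' : B^o) : v \in T -> v' \in T -> v + v' \in T.
  by move=> vT v'T; rewrite -[v]scale1r; apply: Tlin.
have Tscale e (v : B^o) : v \in T -> e *: v \in T.
  by move=> vT; rewrite -[_ *: _]addr0; apply: Tlin.
have [[e [x' [y' [nz x'S y'T E']]]]|disj] := pselect (exists e x' y',
    [/\ e * (u * c) != 0, x' \in S, y' \in T & e * (u * c) = x' + y']).
  exists T; split=> //; have [f fE] := primitive_left_ideal Uu nz.
  exists ((a * f) *: x' + x), ((a * f) *: y' + y); split.
  - exact: Slin.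
  - exact: Tlin.
  - rewrite addrACA -scalerDr -E' -E /GRing.scale /=.
    by rewrite -mulrA -[a * f * _]mulrA fE.
pose T' : {pred B^o} :=
  [pred v | `[< exists e y', y' \in T /\ v = e * (u * c) + y' >]].
exists T'; split.
- split; first by apply/asboolP; exists 0, 0; rewrite mul0r addr0.
  move=> r v v' /asboolP[e [y1 [y1T ->]]] /asboolP[e' [y2 [y2T ->]]].
  apply/asboolP; exists (r * e + e'), (r *: y1 + y2); split; first exact: Tlin.
  by rewrite scalerDr mulrDl addrACA -mulrA.
- move=> v vS /asboolP[e [y' [y'T vE]]].
  have [euc0|euc0] := eqVneq (e * (u * c)) 0.
    by apply: ST0 => //; rewrite vE euc0 add0r.
  case: disj; exists e, v, (- y'); split=> //; last by rewrite vE addrK.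
  by rewrite -scaleN1r; apply: Tscale.
- exists x, (a * (u * c) + y); split=> //.
    by apply/asboolP; exists a, y.
  by rewrite E addrCA mulrA.
Qed.

(** Some u of U and some v satisfy u v <> 0, as the ideal generated by U contains 1.
    An endomorphism sends the generator w = u v = u q w to u q p w, which lies in
    u B u v and is thus a multiple of w. *)
Lemma primitive_generators_split : split_algebra B.
Proof.
move=> V simpleV f; have [v0 v00] := proj1 simpleV.
have [u [v [Uu uv0]]] : exists u (v : V), U u /\ u *: v != 0.
  apply: contrapT => noU.
  have kill x : ideal_generated U x -> forall v : V, x *: v = 0.
    elim=> [v|a u c z Uu _ IH v]; first by rewrite scale0r.
    rewrite scalerDl IH addr0 -!scalerA.
    have [->|ucv] := eqVneq (u *: (c *: v)) 0; first by rewrite scaler0.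
    by case: noU; exists u, (c *: v).
  by case/eqP: v00; rewrite -[v0]scale1r kill.
pose w := u *: v; have [c c0 cE] := UP Uu.
have gen := simple_module_cyclic simpleV uv0.
have [q vE] := gen v; have [p fwE] := gen (f w).
have fw : f w = (c * tau (u * (q * p)))%:A *: w.
  transitivity (f ((u * q) *: w)); first by rewrite -scalerA -vE.
  by rewrite linearZ /= fwE /w !scalerA mulr_algl -cE !mulrA.
exists (c * tau (u * (q * p))) => x; have [r ->] := gen x.
by rewrite linearZ /= -/w fw !scalerA mulr_algr mulr_algl.
Qed.

Lemma primitive_generators_split_semisimple : split_semisimple B.
Proof.
split; first exact: primitive_generators_split.
exact: primitive_generators_semisimple.
Qed.

End PrimitiveGenerators.

(** * Minimal left ideals of a symmetric algebra *)

Section Submodule.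
Variables (R : nzRingType) (V : lmodType R) (S : {pred V}).
Variable subS : GRing.submod_closed S.

(** As for valuation rings, the proof argument serves the inference of the closure
    instance. *)
Definition submodule_pred of GRing.submod_closed S : {pred V} := S.

HB.instance Definition _ :=
  GRing.isSubmodClosed.Build R V (submodule_pred subS) subS.

Definition submodule := {x : V | x \in submodule_pred subS}.

HB.instance Definition _ := [isSub of submodule for val].
HB.instance Definition _ := [Choice of submodule by <:].
HB.instance Definition _ := [SubChoice_isSubLmodule of submodule by <:].

Lemma submodule_simple :
  (exists2 x, x \in S & x != 0) ->
  (forall x, x \in S -> x != 0 -> forall y, y \in S -> exists a, y = a *: x) ->
  simple_module (submodule : lmodType R).
Proof.
move=> [x xS x0] gen; split.
  by exists (exist _ x xS : submodule); rewrite -val_eqE.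
move=> T [T0 Tlin].
have [Tz|] := pselect (forall v, v \in T -> v = 0); first by left.
move=> /existsNP[v /not_implyP[vT v0]]; right=> y.
have [a yE] : exists a, val y = a *: val v.
  apply: gen (valP v) _ _ (valP y).
  by apply: contra_notN v0 => /eqP v0; apply: val_inj.
have -> : y = a *: v + 0 by apply: val_inj; rewrite addr0.
exact: Tlin.
Qed.

End Submodule.

Section LeftIdealRank.
Variables (k : fieldType) (B : algType k) (tau : {scalar B}).
Variables (n : nat) (b d : 'I_n -> B) (bd : dual_bases tau b d).

Definition coord_row (x : B) : 'rV[k]_n := \row_m tau (d m * x).
(** Its row space is the image of the left ideal B x in coordinates. *)
Definition left_ideal_mx (x : B) : 'M[k]_n := \matrix_i coord_row (b i * x).
Definition left_ideal_rank x := \rank (left_ideal_mx x).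

Lemma coord_row_sub x y :
  reflect (exists a, y = a * x) (coord_row y <= left_ideal_mx x)%MS.
Proof.
have lin (D : 'rV_n) :
    coord_row ((\sum_i D 0 i *: b i) * x) = D *m left_ideal_mx x.
  apply/rowP => m; rewrite !mxE mulr_suml mulr_sumr linear_sum.
  apply: eq_bigr => i _; rewrite !mxE.
  by rewrite -scalerAl -scalerAr linearZ.
apply: (iffP submxP) => [[D yE]|[a ->]].
  exists (\sum_i D 0 i *: b i); rewrite -lin in yE.
  rewrite [LHS](proj2 bd) [RHS](proj2 bd); apply: eq_bigr => m _.
  by have /rowP/(_ m) := yE; rewrite !mxE => ->.
exists (coord_row a); rewrite -lin; congr coord_row; congr (_ * _).
by rewrite {1}[a](proj2 bd); apply: eq_bigr => m _; rewrite mxE.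
Qed.

Lemma left_ideal_mx_sub a x : (left_ideal_mx (a * x) <= left_ideal_mx x)%MS.
Proof.
apply/row_subP => i; rewrite rowK; apply/coord_row_sub.
by exists (b i * a); rewrite mulrA.
Qed.

Lemma left_ideal_rank_le a x : (left_ideal_rank (a * x) <= left_ideal_rank x)%N.
Proof. exact/mxrankS/left_ideal_mx_sub. Qed.

Lemma left_ideal_rank_eq a x : left_ideal_rank (a * x) = left_ideal_rank x ->
  exists c, x = c * (a * x).
Proof.
move=> /eqP; rewrite (mxrank_leqif_sup (left_ideal_mx_sub a x)) => sub.
apply/coord_row_sub; apply: submx_trans sub; apply/coord_row_sub.
by exists 1; rewrite mul1r.
Qed.

(** Among the nonzero multiples of x, one of least rank generates a minimal
    left ideal. *)
Lemma exists_simple_left_ideal x : x != 0 -> exists q : B, [/\ q * x != 0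
  & forall a : B, a * (q * x) != 0 -> exists c, q * x = c * (a * (q * x))].
Proof.
move=> x0.
pose Q m := `[< exists q, q * x != 0 /\ left_ideal_rank (q * x) = m >].
have exQ : exists m, Q m.
  by exists (left_ideal_rank (1 * x)); apply/asboolP; exists 1; rewrite mul1r.
case: (ex_minnP exQ) => m /asboolP[q [qx0 qxm]] minm.
exists q; split=> // a aqx0; apply: left_ideal_rank_eq; apply/eqP.
rewrite eqn_leq left_ideal_rank_le qxm minm //.
by apply/asboolP; exists (a * q); rewrite -mulrA.
Qed.

(** Suppose that the product a built so far is not zero in B. Then the left ideal
    B a contains a minimal left ideal B y; some h of H kills this simple module,
    and B h a is strictly smaller than B a: if a = c h a, then y = b h a for some b,
    so that h y = g y with g nonzero by h h = g h, whereas h y = 0. *)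
Lemma annihilating_product (A : nzRingType) (phi : {rmorphism A -> B})
    (H : A -> Prop) :
  (forall h, H h -> forall x, phi h * x = x * phi h) ->
  (forall h, H h -> exists2 g, g != 0 & phi h * phi h = g *: phi h) ->
  (forall V : lmodType B, simple_module V ->
     exists2 h, H h & forall v : V, phi h *: v = 0) ->
  exists2 a, product_of H a & phi a = 0.
Proof.
move=> Hcentral Hsqr Hsimple.
suff desc N a : product_of H a -> (left_ideal_rank (phi a) <= N)%N ->
    exists2 a, product_of H a & phi a = 0.
  by apply: (desc _ 1 (ProductOf1 H) (leqnn _)).
elim: N a => [|N IHN] a Ha.
  rewrite leqn0 mxrank_eq0 => /eqP a0; exists a => //.
  have : (coord_row (phi a) <= left_ideal_mx (phi a))%MS.
    by apply/coord_row_sub; exists 1; rewrite mul1r.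
  rewrite a0 submx0 => /eqP/rowP c0; rewrite [phi a](proj2 bd) big1 // => m _.
  by have := c0 m; rewrite !mxE => ->; rewrite scale0r.
have [a0|a0] := eqVneq (phi a) 0; first by exists a.
move=> raN; have [q [y0 miny]] := exists_simple_left_ideal a0.
set y := q * phi a in y0 miny.
pose S : {pred B^o} := [pred x | `[< exists c, x = c * y >]].
have subS : GRing.submod_closed S.
  split=> [|c x x' /asboolP[e ->] /asboolP[e' ->]]; apply/asboolP.
    by exists 0; rewrite mul0r.
  by exists (c * e + e'); rewrite mulrDl -mulrA.
have yS : y \in S by apply/asboolP; exists 1; rewrite mul1r.
have [|h Hh hkill] := Hsimple (submodule subS).
  apply: submodule_simple; first by exists y.
  move=> x /asboolP[e ->] ey0 x' /asboolP[e' ->]; have [c yE] := miny e ey0.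
  by exists (e' * c); rewrite {1}yE mulrA.
have hy : phi h * y = 0 by have /(congr1 val) := hkill (exist _ y yS).
apply: (IHN (h * a)); first exact: ProductOfM.
rewrite -ltnS; apply: leq_trans raN.
rewrite ltn_neqAle rmorphM left_ideal_rank_le andbT.
apply/eqP => /left_ideal_rank_eq[c aE]; have [g g0 gE] := Hsqr h Hh.
case/eqP: y0; apply: (scalerI g0); rewrite scaler0 -hy.
have yE : y = q * c * phi h * phi a by rewrite /y {1}aE !mulrA.
rewrite {2}yE mulrA mulrA Hcentral // -!mulrA [phi h * (phi h * _)]mulrA gE.
by rewrite -scalerAl -!scalerAr !mulrA -yE.
Qed.

End LeftIdealRank.

(** * The semisimplicity criterion *)

(** Both sides are linear in x, and the elements j (b m) span B. *)
Lemma corner_base_change (R S : comNzRingType) (theta : {rmorphism R -> S})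
    (A : algType R) (B : algType S) (j : {lrmorphism A -> B | theta \; *:%R})
    (t : {scalar A}) (tS : {scalar B}) n (b d : 'I_n -> A) s u :
  dual_bases tS (fun m => j (b m)) (fun m => j (d m)) ->
  (forall a, tS (j a) = theta (t a)) ->
  (forall a, u * a * u = (s * t (u * a)) *: u) ->
  forall x, j u * x * j u = (theta s * tS (j u * x)) *: j u.
Proof.
move=> bdS tSj uau x; rewrite [x](proj2 bdS) mulr_sumr mulr_suml linear_sum.
rewrite mulr_sumr scaler_suml; apply: eq_bigr => m _.
have -> : j u * (tS (j (d m) * x) *: j (b m)) * j u =
    tS (j (d m) * x) *: j (u * b m * u) by rewrite -scalerAr -scalerAl !rmorphM.
rewrite uau -scalerAr !linearZ /= !scalerA rmorphM -tSj rmorphM.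
by congr (_ *: _); ring.
Qed.

Theorem theorem2p4p12 (O : idomainType) (A : algType O)
    (L : fieldType) (theta : {rmorphism O -> L})
    (KA : algType {fraction O})
    (jK : {lrmorphism A -> KA | @FracField.tofrac O \; *:%R})
    (LA : algType L) (jL : {lrmorphism A -> LA | theta \; *:%R})
    (t : {scalar A}) (tK : {scalar KA}) :
  krull_ring O ->
  free_of_finite_rank A ->
  (forall y : L, exists a b : O, theta b != 0 /\ y = theta a / theta b) ->
  is_base_change jK ->
  is_base_change jL ->
  split_semisimple KA ->
  symmetrizing_form t ->
  (forall a : A, tK (jK a) = (t a)%:F) ->
  prime_ideal (ker_pred theta) ->
  has_height (ker_pred theta) 1 ->
  split_semisimple LA <->
  (forall V : lmodType KA, simple_module V ->
     exists2 s : O, is_schur_element tK V s%:F & theta s != 0).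
Proof.
move=> [I [v [dv vO vfin]]] freeA _ jKP jLP [splitKA _] symt tKj primeP heightP.
have [n [b [d bd]]] := symmetrizing_dual_bases freeA symt.
have [tL tLj] := base_change_form jLP t.
have bdK := base_change_dual_bases jKP bd tKj.
have bdL := base_change_dual_bases jLP bd tLj.
have jKinj : injective jK.
  by apply: (base_change_inj bd tKj) => x y /eqP; rewrite tofrac_eq => /eqP.
have [v0 [dv0 [Ov0 denv0]]] := krull_height_one primeP heightP dv vO vfin.
have Ov i (a : O) : a%:F \in vring (dv i).
  have /vO/(_ i) : exists b : O, a%:F = b%:F by exists a.
  by rewrite vringE => -[->|->]; rewrite ?eqxx ?orbT.
have corners (V : lmodType KA) (simpleV : simple_module V) :=
  schur_corners bd tKj jKP simpleV (splitKA V simpleV) primeP Ov0 denv0.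
have schurO (V : lmodType KA) s : simple_module V -> is_schur_element tK V s ->
    exists a : O, s = a%:F.
  move=> simpleV sV; apply/vO => i.
  have := schur_element_integral bd tKj jKP simpleV (splitKA V simpleV)
    (Ov i) sV.
  by rewrite vringE => /orP[/eqP|]; [left | right].
split=> [[_ ssLA] V simpleV|schurV].
  (* if theta s = 0, the reduction of eps i0 vanishes, though tL takes the value
     theta beta on it *)
  have [|s [beta [e [eps [[sV _] [betaP e0] teps corner _]]]]] :=
      corners V simpleV.
    by move=> s; apply: schurO.
  exists s => //; apply: contraNneq betaP => s0.
  pose i0 := Ordinal e0; rewrite inE -(teps i0) -tLj.
  rewrite (_ : jL _ = 0) ?linear0 //.
  apply: semisimple_nilpotent_corner ssLA _ => x.
  by rewrite (corner_base_change bdL tLj (corner i0)) s0 mul0r scale0r.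
pose U u := exists (eps : A) s, [/\ u = jL eps, theta s != 0
  & forall a, eps * a * eps = (s * t (eps * a)) *: eps].
(* h is beta s - beta chi^vee, with g for beta s and z for beta chi^vee *)
pose H h := exists g e (eps : 'I_e -> A), let z := \sum_i eps i in
  [/\ theta g != 0, forall i, U (jL (eps i)), h = g%:A - z,
      forall x, jK z * x = x * jK z & z * z = g *: z].
have [a Ha /eqP] : exists2 a, product_of H a & jK a = 0.
  apply: (annihilating_product bdK).
  - move=> h [g [e [eps [_ _ -> zC _]]]] x.
    rewrite rmorphB /= linearZ /= rmorph1 mulrBl mulrBr zC.
    by rewrite mulr_algl mulr_algr.
  - move=> h [g [e [eps [g0 _ -> _ zz]]]]; exists g%:F.
      by rewrite tofrac_eq0; apply: contraNneq g0 => ->; rewrite rmorph0.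
    rewrite -rmorphM -[RHS]/((@FracField.tofrac O \; *:%R) g _) -linearZ /=.
    congr (jK _); rewrite mulrBl !mulrBr mulr_algl mulr_algr zz mulr_algl.
    by rewrite subrr subr0 scalerBr.
  - move=> V simpleV; have [s' s'V s'0] := schurV V simpleV.
    have [|s [beta [e [eps [[_ sU] [betaP e0] teps corner [zC zV zz]]]]]] :=
        corners V simpleV.
      by move=> s; apply: schurO.
    rewrite (sU _ s'V) in s'0.
    exists ((beta * s)%:A - \sum_i eps i).
      exists (beta * s), e, eps; split=> // [|i].
        by rewrite rmorphM mulf_neq0.
      by exists (eps i), s; split=> // ?; apply: corner.
    move=> u; rewrite rmorphB /= linearZ /= rmorph1 scalerBl zV.
    by rewrite subrr.
rewrite -[0](rmorph0 jK) (inj_eq jKinj) => /eqP a0.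
have [h [g [e [eps [g0 epsU hE _ _]]]]|g g0] :=
    product_ideal_generated (phi := jL) (U := U) _ Ha.
  exists (theta g) => //.
  have -> : jL h - (theta g)%:A = \sum_i (-1 * jL (eps i)).
    have -> : (theta g)%:A = jL g%:A by rewrite linearZ /= rmorph1.
    rewrite -rmorphB hE /= addrAC subrr sub0r rmorphN rmorph_sum /= -sumrN.
    by apply: eq_bigr => i _; rewrite mulN1r.
  apply: (big_ind (ideal_generated U)); first by left.
    by move=> x y; apply: ideal_generated_add.
  by move=> i _; apply/ideal_generated_mull/ideal_generated_gen.
rewrite a0 rmorph0 sub0r => /(ideal_generated_mull (- (g^-1)%:A)).
rewrite mulrNN mulr_algl scalerA mulVf // scale1r => U1.
apply: (primitive_generators_split_semisimple bdL _ U1).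
move=> u [ep [s [-> s0 epE]]].
by exists (theta s) => //; apply: corner_base_change bdL tLj epE.
Qed.
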